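(* Let $A$ be a unital Banach *-algebra such that there exists an injective *-homomorphism $i\colon A\to C(X)$, for some compact space $X$, for which $A$ has norm-controlled inversion in $C(X)$. Assume that one of the following two cases holds: (1) $A=C(X)$; or (2) $A=E^*$ is a dual Banach algebra that shares with $X$ densely many points (with respect to $i$). Then multiplication in $A$ is open at all pairs of jointly non-degenerate elements of $A$. Furthermore, suppose that $i$ has dense range in $C(X)$. If $A$ has open multiplication, then the maximal ideal space of $A$ is of (covering) dimension at most $1$.
   Context: All Banach algebras are over $\mathbb C$; compact spaces are Hausdorff; homomorphisms between unital Banach algebras preserve the unit. $C(X)$ is the algebra of continuous complex-valued functions on $X$ with the supremum norm and complex conjugation as involution. Norm-controlled inversion: for a unital continuous injective homomorphism $i\colon A\to B$ of unital Banach algebras, $A$ admits (has) norm-controlled inversion in $B$ if there is a function $h\colon(0,\infty)^2\to(0,\infty)$ such that for every $a\in A$ that is invertible in $B$ (i.e. $i(a)$ is invertible in $B$), the inverse lies in $A$ and $\|a^{-1}\|_A\leqslant h(\|a\|_A,\|i(a^{-1})\|_B)$. Dual Banach algebra: a Banach algebra $A$ that is the dual space $E^*$ of some Banach space $E$ and whose multiplication is separately $\sigma(A,E)$-continuous. Sharing densely many points: if $A=E^*$ is a dual Banach algebra and $i\colon A\to C(X)$ is an injective homomorphism, then $A$ shares with $X$ densely many points if there is a dense set $Q\subset X$ such that for every $x\in Q$ the functional $i^*(\delta_x)=\delta_x\circ i$ belongs to $E$ (i.e. is $\sigma(A,E)$-continuous), where $\delta_x\in C(X)^*$ is evaluation at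 $x$. Jointly non-degenerate: $a,b\in A$ are jointly non-degenerate if $|a|^2+|b|^2$ is invertible in $A$, where $|a|^2=a^*a$. Openness: multiplication in $A$ is open at a pair $(F,G)\in A\times A$ if for every $\varepsilon>0$ there is $\delta>0$ such that $B_A(FG,\delta)\subseteq B_A(F,\varepsilon)\cdot B_A(G,\varepsilon)=\{fg: f\in B_A(F,\varepsilon),\, g\in B_A(G,\varepsilon)\}$, where $B_A(x,r)$ is the ball of radius $r$ centred at $x$. $A$ has open multiplication if the map $A\times A\to A$, $(a,b)\mapsto ab$, maps open sets to open sets. *)

(* Defs.v *)
From HB Require Import structures.
From mathcomp Require Import all_boot all_order all_algebra.
From mathcomp Require Import all_classical all_reals all_analysis.
From mathcomp Require Import complex ring.
Set Implicit Arguments.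
Unset Strict Implicit.
Unset Printing Implicit Defensive.
Import Order.TTheory GRing.Theory Num.Theory.
Import numFieldNormedType.Exports.
Local Open Scope classical_set_scope.
Local Open Scope complex_scope.
Local Open Scope ring_scope.

HB.instance Definition _ (R : realType) := GRing.ComAlgebra.copy R[i] R[i]^o.
HB.instance Definition _ (R : realType) := PseudoPointedMetric.copy R[i] R[i]^o.
HB.instance Definition _ (R : realType) := NormedModule.copy R[i] R[i]^o.

Section ComplexPlane.
Variable R : realType.
Implicit Types (z : R[i]) (r : R).

Lemma normcRe z : `|z| = (complex.Re `|z|)%:C.
Proof. by case: z. Qed.

Lemma Re_norm_ge0 z : 0 <= complex.Re `|z|.
Proof. by rewrite -lecR -normcRe normr_ge0. Qed.

Lemma gt0cRe z : 0 < z -> z = (complex.Re z)%:C.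
Proof. by case: z => a b /=; rewrite ltcE /= => /andP[/eqP -> _]. Qed.

Lemma Re_gt0 z : 0 < z -> 0 < complex.Re z.
Proof. by move=> z0; rewrite -ltcR -gt0cRe. Qed.

Lemma le_Re_norm z : `|complex.Re z| <= complex.Re `|z|.
Proof.
case: z => a b /=; rewrite -sqrtr_sqr ler_wsqrtr//.
by rewrite lerDl sqr_ge0.
Qed.

Lemma le_Im_norm z : `|complex.Im z| <= complex.Re `|z|.
Proof.
case: z => a b /=; rewrite -sqrtr_sqr ler_wsqrtr//.
by rewrite lerDr sqr_ge0.
Qed.

Lemma norm_le_ReIm z :
  complex.Re `|z| <= `|complex.Re z| + `|complex.Im z|.
Proof.
rewrite -(@ler_pXn2r _ 2)// ?nnegrE ?Re_norm_ge0 ?addr_ge0//.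
case: z => a b /=.
rewrite sqr_sqrtr ?addr_ge0 ?sqr_ge0// sqrrD !real_normK ?num_real// addrAC lerDl.
by rewrite mulrn_wge0// mulr_ge0.
Qed.

Lemma continuous_Re : continuous (@complex.Re R).
Proof.
move=> z; apply/(@cvgrPdist_lt _ _ _ (nbhs z)) => e e0; apply/nbhs_ballP.
exists e%:C => [|w]; first by rewrite /= ltcR.
rewrite /ball /= normcRe ltcR => zw.
by rewrite -raddfB; apply: le_lt_trans (le_Re_norm _) _.
Qed.

Lemma complex_complete (F : set_system R[i]) :
  ProperFilter F -> cauchy F -> cvg F.
Proof.
move=> FF /cauchyP Fc.
have F2 (p : R[i] -> R) : (forall z w, `|p z - p w| <= complex.Re `|z - w|) ->
    cvg (p @ F).
  move=> pE; apply: cauchy_cvg; apply/cauchyP => e e0.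
  have /Fc[z Fz] : 0 < e%:C by rewrite ltcR.
  exists (p z); suff: F [set w | ball (p z) e (p w)] by [].
  apply: filterS Fz => w; rewrite /ball /= => zw.
  by apply: le_lt_trans (pE _ _) _; rewrite -ltcR -normcRe.
have /cvg_ex[a Fa] : cvg (@complex.Re R @ F).
  by apply: F2 => z w; rewrite -raddfB le_Re_norm.
have /cvg_ex[b Fb] : cvg (@complex.Im R @ F).
  by apply: F2 => z w; rewrite -raddfB le_Im_norm.
apply/cvg_ex; exists (a +i* b); apply/cvgrPdist_lt => e e0.
rewrite (gt0cRe e0).
have e20 : 0 < complex.Re e / 2 by rewrite divr_gt0// Re_gt0.
have Fae : F [set z | `|a - complex.Re z| < complex.Re e / 2].
  exact: (@cvgrPdist_lt _ _ _ F _ _ _).1 Fa _ e20.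
have Fbe : F [set z | `|b - complex.Im z| < complex.Re e / 2].
  exact: (@cvgrPdist_lt _ _ _ F _ _ _).1 Fb _ e20.
apply: filterS2 Fae Fbe => z za zb; rewrite normcRe ltcR.
apply: le_lt_trans (norm_le_ReIm _) _.
by case: z za zb => x y /= za zb; rewrite [ltRHS]splitr ltrD.
Qed.

HB.instance Definition _ := Uniform_isComplete.Build R[i] complex_complete.

End ComplexPlane.

(* A structure joining algType and normedModType would have to be declared
   before numDomainType, which inherits from both a ring and a norm. Hence the
   norm is a mixin over algType, and the normed topology is attached below to
   the carriers; `|x| and bnorm x are convertible there. Algebras are unital
   with 1 <> 0; neither `|1| = 1 nor an isometric involution is required. *)
HB.mixin Record hasBanachNorm (K : numFieldType) A & GRing.Algebra K A := {
  bnorm : A -> K ;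
  bnormD : forall x y, bnorm (x + y) <= bnorm x + bnorm y ;
  bnormZ : forall (c : K) x, bnorm (c *: x) = `|c| * bnorm x ;
  bnorm0_eq0 : forall x, bnorm x = 0 -> x = 0 ;
  bnormM : forall x y, bnorm (x * y) <= bnorm x * bnorm y ;
  bnorm_complete : forall F : set_system A, ProperFilter F ->
    (forall e : K, 0 < e -> exists x, F [set y | bnorm (x - y) < e]) ->
    exists x, forall e : K, 0 < e -> F [set y | bnorm (x - y) < e]
}.

#[short(type="banachAlgType")]
HB.structure Definition BanachAlgebra (K : numFieldType) :=
  {A of GRing.Algebra K A & hasBanachNorm K A}.

HB.mixin Record hasInvolution (K : numClosedFieldType) A
    & BanachAlgebra K A := {
  star : A -> A ;
  starK : involutive star ;
  starD : {morph star : x y / x + y} ;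
  starZ : forall (c : K) x, star (c *: x) = c^*%R *: star x ;
  starM : forall x y, star (x * y) = star y * star x
}.

#[short(type="banachStarAlgType")]
HB.structure Definition BanachStarAlgebra (K : numClosedFieldType) :=
  {A of BanachAlgebra K A & hasInvolution K A}.

Section BanachTopology.
Variables (K : numFieldType) (A : banachAlgType K).

#[non_forgetful_inheritance]
HB.instance Definition _ := Lmodule_isNormed.Build K (BanachAlgebra.sort A)
  (@bnormD K A) (@bnormZ K A) (@bnorm0_eq0 K A).

Lemma banach_complete (F : set_system A) :
  ProperFilter F -> cauchy F -> cvg F.
Proof.
move=> FF /cauchyP Fc.
have [e /Fc[x Fx]|x Fx] := @bnorm_complete K A F FF; first by exists x.
by apply/cvg_ex; exists x; apply/cvgrPdist_lt.
Qed.

#[non_forgetful_inheritance]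
HB.instance Definition _ :=
  Uniform_isComplete.Build (BanachAlgebra.sort A) banach_complete.

End BanachTopology.

#[non_forgetful_inheritance]
HB.instance Definition _ (K : numClosedFieldType) (A : banachStarAlgType K) :=
  CompleteNormedModule.copy (BanachStarAlgebra.sort A) (BanachAlgebra.sort A).


(* Pointedness only records that X is nonempty, i.e., that 1 <> 0 in C(X). *)
HB.mixin Record isCompactHausdorff X & Topological X := {
  compact_space : compact [set: X] ;
  hausdorff_compact_space : hausdorff_space X
}.

#[short(type="compactHausdorffType")]
HB.structure Definition CompactHausdorff :=
  {X of PointedTopological X & isCompactHausdorff X}.

Definition cfun (R : realType) (X : compactHausdorffType) : Type :=
  continuousType X R[i].

Section ContinuousFunctions.
Variables (R : realType) (X : compactHausdorffType).
Local Notation CX := (cfun R X).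
Implicit Types f g h : CX.

HB.instance Definition _ := Choice.on CX.

Definition mkcfun (f : X -> R[i]) (fc : continuous f) : CX := mkcts fc.

Lemma cfunP f g : f =1 g -> f = g.
Proof. by move/continuousEP. Qed.

Lemma cfun_cont f : continuous f.
Proof. exact: cts_fun. Qed.

Fact cfun0_cont : continuous (fun _ : X => 0 : R[i]).
Proof. by move=> x; exact: cvg_cst. Qed.
Fact cfun1_cont : continuous (fun _ : X => 1 : R[i]).
Proof. by move=> x; exact: cvg_cst. Qed.
Fact cfunN_cont f : continuous (fun x => - f x).
Proof. by move=> x; apply: cvgN; exact: cfun_cont. Qed.
Fact cfunD_cont f g : continuous (fun x => f x + g x).
Proof. by move=> x; apply: cvgD; exact: cfun_cont. Qed.
Fact cfunM_cont f g : continuous (fun x => f x * g x).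
Proof. by move=> x; apply: cvgM; exact: cfun_cont. Qed.
Fact cfunZ_cont (c : R[i]) f : continuous (fun x => c * f x).
Proof. by move=> x; apply: cvgM; [exact: cvg_cst | exact: cfun_cont]. Qed.
Fact cfunJ_cont f : continuous (fun x => (f x)^*%R).
Proof.
move=> x; apply/(@cvgrPdist_lt _ _ _ (nbhs x)) => e e0.
have /(@cvgrPdist_lt _ _ _ (nbhs x))/(_ e e0) := @cfun_cont f x.
by apply: filterS => y; rewrite -rmorphB norm_conjC.
Qed.

Definition cfun0 := mkcfun cfun0_cont.
Definition cfun1 := mkcfun cfun1_cont.
Definition cfunN f := mkcfun (@cfunN_cont f).
Definition cfunD f g := mkcfun (@cfunD_cont f g).
Definition cfunM f g := mkcfun (@cfunM_cont f g).
Definition cfunZ c f := mkcfun (@cfunZ_cont c f).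
Definition cfunJ f := mkcfun (@cfunJ_cont f).

Fact cfunDA : associative cfunD.
Proof. by move=> f g h; apply: cfunP => x; exact: addrA. Qed.
Fact cfunDC : commutative cfunD.
Proof. by move=> f g; apply: cfunP => x; exact: addrC. Qed.
Fact cfun0D : left_id cfun0 cfunD.
Proof. by move=> f; apply: cfunP => x; exact: add0r. Qed.
Fact cfunND : left_inverse cfun0 cfunN cfunD.
Proof. by move=> f; apply: cfunP => x; exact: addNr. Qed.

HB.instance Definition _ :=
  GRing.isZmodule.Build CX cfunDA cfunDC cfun0D cfunND.

Fact cfunMA : associative cfunM.
Proof. by move=> f g h; apply: cfunP => x; exact: mulrA. Qed.
Fact cfunMC : commutative cfunM.
Proof. by move=> f g; apply: cfunP => x; exact: mulrC. Qed.
Fact cfun1M : left_id cfun1 cfunM.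
Proof. by move=> f; apply: cfunP => x; exact: mul1r. Qed.
Fact cfunMDl : left_distributive cfunM cfunD.
Proof. by move=> f g h; apply: cfunP => x; exact: mulrDl. Qed.
Fact cfun1_neq0 : cfun1 != 0 :> CX.
Proof.
apply/eqP => /continuousEP/(_ point) /= /eqP; apply/negP; exact: oner_neq0.
Qed.

HB.instance Definition _ := GRing.Zmodule_isComNzRing.Build CX
  cfunMA cfunMC cfun1M cfunMDl cfun1_neq0.

Fact cfunZA c d f : cfunZ c (cfunZ d f) = cfunZ (c * d) f.
Proof. by apply: cfunP => x; exact: mulrA. Qed.
Fact cfun1Z : left_id 1 cfunZ.
Proof. by move=> f; apply: cfunP => x; exact: mul1r. Qed.
Fact cfunZDr : right_distributive cfunZ cfunD.
Proof. by move=> c f g; apply: cfunP => x; exact: mulrDr. Qed.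
Fact cfunZDl f : {morph cfunZ^~ f : c d / c + d}.
Proof. by move=> c d; apply: cfunP => x; exact: mulrDl. Qed.

HB.instance Definition _ := GRing.Zmodule_isLmodule.Build R[i] CX
  cfunZA cfun1Z cfunZDr cfunZDl.

Fact cfunZAl (c : R[i]) f g : c *: (f * g) = (c *: f) * g.
Proof. by apply: cfunP => x; exact: mulrA. Qed.

HB.instance Definition _ := GRing.Lmodule_isLalgebra.Build R[i] CX cfunZAl.

Fact cfunZAr (c : R[i]) f g : c *: (f * g) = f * (c *: g).
Proof. by apply: cfunP => x; exact: mulrCA. Qed.

HB.instance Definition _ := GRing.Lalgebra_isAlgebra.Build R[i] CX cfunZAr.

Definition cfun_norm f : R[i] :=
  (sup [set complex.Re `|f x| | x in [set: X]])%:C.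

Lemma cfun_norm_has_ubound f :
  has_ubound [set complex.Re `|f x| | x in [set: X]].
Proof.
have cN : continuous (fun x => complex.Re `|f x|).
  move=> x; apply: (continuous_comp (f := fun x => `|f x|)).
    by apply: cvg_norm; exact: cfun_cont.
  exact: continuous_Re.
have /compact_bounded[M [_ HM]] :
    compact [set complex.Re `|f x| | x in [set: X]].
  apply: continuous_compact; last exact: compact_space.
  by apply: continuous_subspaceT.
exists (M + 1) => r fr.
by apply: le_trans (ler_norm _) _; apply: HM fr; rewrite ltrDl.
Qed.

Lemma le_cfun_norm f x : `|f x| <= cfun_norm f.
Proof.
rewrite normcRe lecR; apply: ub_le_sup; first exact: cfun_norm_has_ubound.
by exists x.
Qed.

Lemma cfun_norm_le f c : (forall x, `|f x| <= c) -> cfun_norm f <= c.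
Proof.
move=> fc; have c0 : 0 <= c := le_trans (normr_ge0 _) (fc point).
have cE : c = (complex.Re c)%:C by rewrite -(ger0_norm c0) -normcRe.
rewrite cE lecR; apply: ge_sup; first by exists (complex.Re `|f point|), point.
by move=> _ [x _ <-]; rewrite -lecR -normcRe -cE.
Qed.

Lemma cfun_norm_ge0 f : 0 <= cfun_norm f.
Proof. exact: le_trans (normr_ge0 _) (le_cfun_norm f point). Qed.

Fact cfun_normD f g : cfun_norm (f + g) <= cfun_norm f + cfun_norm g.
Proof.
apply: cfun_norm_le => x; apply: le_trans (ler_normD _ _) _.
by rewrite lerD ?le_cfun_norm.
Qed.

Fact cfun_normM f g : cfun_norm (f * g) <= cfun_norm f * cfun_norm g.
Proof.
apply: cfun_norm_le => x; rewrite -[(f * g) x]/(f x * g x) normrM.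
by rewrite ler_pM ?le_cfun_norm.
Qed.

Fact cfun_normZ (c : R[i]) f : cfun_norm (c *: f) = `|c| * cfun_norm f.
Proof.
apply/eqP; rewrite eq_le; apply/andP; split.
  apply: cfun_norm_le => x; rewrite -[(c *: f) x]/(c * f x) normrM.
  by rewrite ler_wpM2l ?le_cfun_norm.
have [->|c0] := eqVneq c 0; first by rewrite normr0 mul0r cfun_norm_ge0.
rewrite mulrC -ler_pdivlMr ?normr_gt0//; apply: cfun_norm_le => x.
rewrite ler_pdivlMr ?normr_gt0// mulrC -normrM.
exact: (le_cfun_norm (c *: f)).
Qed.

Fact cfun_norm0_eq0 f : cfun_norm f = 0 -> f = 0.
Proof.
move=> f0; apply: cfunP => x; apply/eqP; rewrite -normr_le0 -f0.
exact: le_cfun_norm.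
Qed.

Fact cfun_complete (F : set_system CX) : ProperFilter F ->
  (forall e : R[i], 0 < e -> exists f, F [set g | cfun_norm (f - g) < e]) ->
  exists f, forall e : R[i], 0 < e -> F [set g | cfun_norm (f - g) < e].
Proof.
move=> FF Fc.
have cvx x : cvg ((fun f : CX => f x : R[i]) @ F).
  apply: cauchy_cvg; apply/cauchyP => e /Fc[f Ff]; exists (f x).
  suff: F [set g : CX | ball (f x) e (g x)] by [].
  apply: filterS Ff => g fg; apply: le_lt_trans fg.
  exact: (le_cfun_norm (f - g)).
pose l x : R[i] := lim ((fun f : CX => f x : R[i]) @ F).
have Fl e : 0 < e -> F [set f | forall x, `|l x - f x| < e].
  move=> e0; have e20 : 0 < e / 2 by rewrite divr_gt0.
  have e40 : 0 < e / 2 / 2 by rewrite divr_gt0.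
  have [f Ff] := Fc _ e40; apply: filterS (Ff) => g fg x.
  have Fx : F [set h : CX | `|l x - h x| < e / 2].
    exact: (@cvgrPdist_lt _ _ _ F _ _ _).1 (cvx x) _ e20.
  have [h [/= fh hx]] := filter_ex (filterI Ff Fx).
  rewrite [e]splitr -(subrK (h x) (l x)) -addrA.
  apply: le_lt_trans (ler_normD _ _) _; rewrite ltrD//.
  rewrite [e / 2]splitr -(subrK (f x) (h x)) -addrA.
  apply: le_lt_trans (ler_normD _ _) _; rewrite ltrD//.
    rewrite distrC; apply: le_lt_trans fh.
    exact: (le_cfun_norm (f - h)).
  apply: le_lt_trans fg; exact: (le_cfun_norm (f - g)).
have lc : continuous l.
  move=> x; apply/(@cvgrPdist_lt _ _ _ (nbhs x)) => e e0.
  have e30 : 0 < e / 3 by rewrite divr_gt0.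
  have [f /= fl] := filter_ex (Fl _ e30).
  have /(@cvgrPdist_lt _ _ _ (nbhs x))/(_ _ e30) := @cfun_cont f x.
  apply: filterS => y fxy.
  have -> : e = e / 3 + (e / 3 + e / 3) by field.
  have -> : l x - l y = (l x - f x) + ((f x - f y) + (f y - l y)).
    by rewrite !subrKA.
  apply: le_lt_trans (ler_normD _ _) _; rewrite ltrD//.
  apply: le_lt_trans (ler_normD _ _) _; rewrite ltrD//.
  by rewrite distrC.
exists (mkcfun lc) => e e0.
have e20 : 0 < e / 2 by rewrite divr_gt0.
apply: filterS (Fl _ e20) => f fl /=.
apply: (@le_lt_trans _ _ (e / 2)); last by rewrite ltr_pdivrMr// ltr_pMr// ltr1n.
by apply: cfun_norm_le => x; apply: ltW; exact: fl.
Qed.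

HB.instance Definition _ := hasBanachNorm.Build R[i] CX
  cfun_normD cfun_normZ cfun_norm0_eq0 cfun_normM cfun_complete.

Fact cfunJK : involutive cfunJ.
Proof. by move=> f; apply: cfunP => x; exact: conjCK. Qed.
Fact cfunJD : {morph cfunJ : f g / f + g}.
Proof. by move=> f g; apply: cfunP => x; exact: (rmorphD (@Num.conj R[i])). Qed.
Fact cfunJZ (c : R[i]) f : cfunJ (c *: f) = c^*%R *: cfunJ f.
Proof. by apply: cfunP => x; exact: (rmorphM (@Num.conj R[i])). Qed.
Fact cfunJM f g : cfunJ (f * g) = cfunJ g * cfunJ f.
Proof.
apply: cfunP => x; apply: etrans (mulrC _ _).
exact: (rmorphM (@Num.conj R[i])).
Qed.

HB.instance Definition _ := hasInvolution.Build R[i] CX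
  cfunJK cfunJD cfunJZ cfunJM.

End ContinuousFunctions.

HB.instance Definition _ (R : realType) (X : compactHausdorffType) :=
  CompleteNormedModule.copy (cfun R X)
    (BanachStarAlgebra.sort (cfun R X : banachStarAlgType R[i])).

Definition is_inverse (A : pzRingType) (a b : A) := a * b = 1 /\ b * a = 1.

Definition invertible (A : pzRingType) (a : A) := exists b, is_inverse a b.

(* The positive elements of K = R[i] are the positive real numbers. *)
Definition norm_controlled_inversion (K : numFieldType) (A B : banachAlgType K)
    (i : {lrmorphism A -> B}) :=
  [/\ continuous i, injective i
    & exists h : K -> K -> K,
        (forall s t, 0 < s -> 0 < t -> 0 < h s t) /\
        forall (a : A) (b : B), is_inverse (i a) b ->
          exists2 a' : A, is_inverse a a' & `|a'| <= h `|a| `|b|].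

Definition star_preserving (K : numClosedFieldType) (A B : banachStarAlgType K)
    (i : A -> B) := forall a, i (star a) = star (i a).

(* A = C(X) as Banach *-algebras, i.e., up to isometric *-isomorphism. *)
Definition is_cfun_algebra (R : realType) (X : compactHausdorffType)
    (A : banachStarAlgType R[i]) :=
  exists j : {lrmorphism A -> cfun R X},
    [/\ star_preserving j, forall a, `|j a| = `|a| & range j = setT].

Section DualBanachAlgebra.
Variables (R : realType) (A : banachAlgType R[i]) (E : completeNormedModType R[i]).
Variable J : A -> {linear E -> R[i]}.

(* J a e is the duality bracket <a, e>: identifies_with_dual says that
   a |-> <a, .> is an isometric isomorphism of A onto the dual of E, and e in E
   is seen as the functional <., e> on A. *)

Definition functional_norm (f : E -> R[i]) : R[i] :=
  (sup [set complex.Re `|f e| | e in [set e : E | `|e| <= 1]])%:C.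

Record identifies_with_dual : Prop := IdentifiesWithDual {
  dual_continuous : forall a, continuous (J a) ;
  dual_linear : forall (c : R[i]) a b e, J (c *: a + b) e = c * J a e + J b e ;
  dual_isometry : forall a, `|a| = functional_norm (J a) ;
  dual_onto : forall f : {linear E -> R[i]}, continuous f ->
    exists a, forall e, J a e = f e
}.

(* A with the topology sigma(A, E), as an alias of A. *)
Definition weak_star : Type :=
  initial_topology (fun a : A => (fun e : E => J a e) : {ptws E -> R[i]}).

HB.instance Definition _ := Topological.on weak_star.

Definition dual_banach_algebra :=
  identifies_with_dual /\
  forall a : A, continuous ((fun x : A => a * x) : weak_star -> weak_star) /\
                continuous ((fun x : A => x * a) : weak_star -> weak_star).

Definition shares_densely_many_points (X : compactHausdorffType)
    (i : A -> cfun R X) :=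
  exists Q : set X, dense Q /\
    forall x, Q x -> exists e : E, forall a : A, i a x = J a e.

End DualBanachAlgebra.

Definition jointly_non_degenerate (K : numClosedFieldType)
    (A : banachStarAlgType K) (a b : A) := invertible (star a * a + star b * b).

Definition open_multiplication_at (K : numFieldType) (A : banachAlgType K)
    (F G : A) :=
  forall e : K, 0 < e -> exists2 d : K, 0 < d &
    ball (F * G) d `<=` [set f * g | f in ball F e & g in ball G e].

Definition has_open_multiplication (K : numFieldType) (A : banachAlgType K) :=
  forall U : set (A * A), open U -> open [set p.1 * p.2 | p in U].

Definition character (R : realType) (A : banachAlgType R[i]) : Type :=
  {lrmorphism A -> R[i]}.

HB.instance Definition _ (R : realType) (A : banachAlgType R[i]) :=
  gen_eqMixin (character A).
HB.instance Definition _ (R : realType) (A : banachAlgType R[i]) :=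
  gen_choiceMixin (character A).

(* Maximal ideals of a commutative unital Banach algebra are identified with
   characters; the Gelfand topology is that of pointwise convergence on A. *)
Definition maximal_ideal_space (R : realType) (A : banachAlgType R[i]) : Type :=
  initial_topology (fun phi : character A =>
    ((phi : {lrmorphism A -> R[i]}) : {ptws A -> R[i]})).

HB.instance Definition _ (R : realType) (A : banachAlgType R[i]) :=
  Topological.on (maximal_ideal_space A).

Definition open_cover (T : topologicalType) (U : set (set T)) :=
  (forall u, U u -> open u) /\ \bigcup_(u in U) u = setT.

(* The order of the refinement V is the largest n such that some point lies in
   n + 1 distinct members of V. *)
Definition covering_dim_le (T : topologicalType) (n : nat) :=
  forall U : set (set T), finite_set U -> open_cover U ->
    exists V : set (set T), [/\ finite_set V, open_cover V,
      forall v, V v -> exists2 u, U u & v `<=` u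
      & forall x, ([set v | V v /\ v x] #<= `I_n.+1)%card].

(* Main.v *)
From HB Require Import structures.
Require Import Defs.
From mathcomp Require Import all_boot all_order all_algebra.
From mathcomp Require Import all_classical all_reals all_analysis.
From mathcomp Require Import complex ring lra.
Import Order.TTheory GRing.Theory Num.Theory.
Import numFieldNormedType.Exports.
Local Open Scope classical_set_scope.
Local Open Scope complex_scope.
Local Open Scope ring_scope.

(** The algebra A is commutative, since i embeds it into C(X).

    Openness at a jointly non-degenerate pair (F, G). Put
    s = F^* F + G^* G and look for factors of F G + u of the special form
    F + G^* z and G + F^* z. Their product is
    F G + s z + F^* G^* z^2, so the equation to solve is
    z = s^-1 u - s^-1 F^* G^* z^2. For small u the right-hand side is a
    contraction of a small ball, and Banach's fixed point theorem gives a small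
    root z ([quadratic_small_root]). Joint non-degeneracy is exactly the
    invertibility of s.

    The bound on the dimension. If multiplication is open at (a, a^* ), then
    a a^* + c with a small scalar c > 0 is a product b b' with b close to a. Its
    image in C(X) is |i a|^2 + c, which has no zero, so i b has no zero. As the
    range of i is dense, every continuous complex function on X is a uniform
    limit of nowhere vanishing ones
    ([open_multiplication_nonvanishing_dense]).

    Such approximations force dim X <= 1. A cover of X by three open sets gives
    bump functions p1, p2, p3, hence a map (p1 - p3) + i (p2 - p3) into the
    plane. It sends x to 0 iff the three values p_j(x) coincide. After a
    perturbation that avoids 0, the corresponding three quantities are never all
    equal; keeping in the j-th set only the points where the j-th quantity is not
    minimal yields a smaller cover without triple intersection
    ([nonvanishing_dense_three_sets]). Treating the triples of members of a
    finite cover one after the other, with the third set replaced by the union of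
    all remaining members, removes all triple intersections
    ([finite_family_shrinking]).

    Finally X is the maximal ideal space of A. Inverses in C(X) of elements of A
    lie in A, so a character that differs from all evaluations would contain in
    its kernel an invertible element sum_k a_k^* a_k ([character_evaluation]);
    and since the range of i is dense, elements of A separate the points of X
    from closed sets, so that evaluation is a homeomorphism of X onto the
    character space ([covering_dim_maximal_ideal_space]). *)

(** * A fixed point and a quadratic equation *)

Lemma half_power_lt (R : realType) (e : R[i]) : 0 < e ->
  exists n : nat, 2^-1 ^+ n < e.
Proof.
move=> e0; have re0 := Re_gt0 e0.
have [n _ /(_ n (leqnn n))] : \forall n \near \oo, `|0 - (2^-1 : R) ^+ n| < complex.Re e.
  have /cvgrPdist_lt/(_ _ re0) : (2^-1 : R) ^+ n @[n --> \oo] --> (0 : R).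
    by apply: cvg_expr; rewrite ger0_norm; lra.
  by [].
rewrite /= sub0r normrN ger0_norm ?exprn_ge0// => ne.
exists n; rewrite (gt0cRe e0).
have -> : (2^-1 : R[i]) = (2^-1 : R)%:C by rewrite fmorphV/= rmorph_nat.
by rewrite -rmorphXn ltcR.
Qed.

(** The Banach fixed point theorem on a closed ball, for complex scalars: the
    iterates of 0 satisfy |y_m - y_n| <= 2 r 2^-n for m >= n, hence converge. *)
Lemma half_contraction_fixpoint (R : realType) (V : completeNormedModType R[i])
    (T : V -> V) (r : R[i]) : 0 < r ->
  (forall x, `|x| <= r -> `|T x| <= r) ->
  (forall x y, `|x| <= r -> `|y| <= r -> `|T x - T y| <= 2^-1 * `|x - y|) ->
  exists2 x, `|x| <= r & T x = x.
Proof.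
move=> r0 Tr Tc; pose y n := iter n T 0.
have yr n : `|y n| <= r.
  by elim: n => [|n ih]; [rewrite normr0 ltW | exact: Tr].
have y1 n : `|y n.+1 - y n| <= 2^-1 ^+ n * r.
  elim: n => [|n ih]; first by rewrite mul1r subr0 yr.
  apply: le_trans (Tc (y n.+1) (y n) (yr _) (yr _)) _.
  by rewrite exprS -mulrA ler_wpM2l.
have ynm n m : `|y (n + m)%N - y n| <= 2 * r * (2^-1 ^+ n - 2^-1 ^+ (n + m)).
  elim: m => [|m ih]; first by rewrite addn0 !subrr normr0 mulr0.
  rewrite -(subrKA (y (n + m)%N)); apply: le_trans (ler_normD _ _) _.
  rewrite addnS; apply: le_trans (lerD (y1 _) ih) _; rewrite exprS le_eqVlt; apply/orP; left.
  by apply/eqP; field.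
have ylt e : 0 < e -> exists n, forall m, (n <= m)%N -> `|y n - y m| < e.
  move=> e0; have [|n ne] := @half_power_lt R (e / (2 * r)).
    by rewrite divr_gt0 ?mulr_gt0.
  exists n => m /subnKC <-; rewrite distrC; apply: le_lt_trans (ynm _ _) _.
  rewrite mulrC -ltr_pdivlMr ?mulr_gt0//; apply: le_lt_trans ne.
  by rewrite lerBlDr lerDl exprn_ge0// invr_ge0.
have /cvg_ex[l /cvgrPdist_lt yl] : cvg (y @ \oo).
  apply: cauchy_cvg; apply/cauchyP => e e0; have [n ne] := ylt e e0.
  by exists (y n); exists n => // m /= nm; rewrite -ball_normE; exact: ne.
have lr : `|l| <= r.
  apply/ler_addgt0Pl => e e0; have [n _ /(_ n (leqnn n)) ln] := yl e e0.
  rewrite -(subrK (y n) l); apply: le_trans (ler_normD _ _) _.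
  by rewrite lerD// ltW.
exists l => //; apply/eqP; rewrite -subr_eq0 -normr_le0.
apply/ler_addgt0Pl => e e0; rewrite addr0.
have [n _ ln] := yl (e / 2) (divr_gt0 e0 (ltr0Sn _ 1)).
rewrite -(subrKA (y n.+1)) [leRHS]splitr; apply: le_trans (ler_normD _ _) _.
apply: lerD; last by rewrite distrC ltW// ln/=.
apply: le_trans (Tc _ _ lr (yr n)) _.
apply: le_trans (ltW (ln n (leqnn n))).
by rewrite ler_piMl// invf_le1// ler1n.
Qed.

(** On the ball of radius s the map z |-> p u - q z^2 is 1/2-Lipschitz as soon as
    4 |q| s <= 1, and it preserves the ball when moreover |p u| <= s / 2. *)
Lemma quadratic_small_root (R : realType) (A : banachAlgType R[i]) (p q : A)
    (r : R[i]) : 0 < r ->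
  exists2 d : R[i], 0 < d & forall u : A, `|u| < d ->
    exists2 z : A, `|z| <= r & z = p * u - q * (z * z).
Proof.
(* A radius with both s <= r and 4 |q| s <= 1, without a case distinction. *)
move=> r0; pose s := (r^-1 + 4 * `|q|)^-1.
have normM (x y : A) : `|x * y| <= `|x| * `|y| by exact: bnormM.
have q0 : 0 <= 4 * `|q| by rewrite mulr_ge0.
have s0 : 0 < s by rewrite invr_gt0 ltr_pwDl ?invr_gt0.
have sr : s <= r.
  by rewrite -[leRHS]invrK lef_pV2 ?posrE ?invr_gt0 ?ltr_pwDl ?invr_gt0// lerDl.
have qs : 4 * `|q| * s <= 1.
  by rewrite ler_pdivrMr ?ltr_pwDl ?invr_gt0// mul1r lerDr invr_ge0 ltW.
have qM (x y : A) t : 0 <= t -> `|x| * `|y| <= s * t -> `|q * (x * y)| <= 4^-1 * t.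
  move=> t0 xyt; apply: le_trans (normM _ _) _.
  apply: le_trans (ler_wpM2l (normr_ge0 q) (le_trans (normM _ _) xyt)) _.
  have -> : `|q| * (s * t) = (4 * `|q| * s) * (4^-1 * t) by field.
  by rewrite ler_piMl// mulr_ge0.
have p0 : 0 < `|p| + 1 by rewrite ltr_wpDl.
exists (2^-1 * s / (`|p| + 1)) => [|u ud].
  by rewrite divr_gt0// mulr_gt0.
have pu : `|p * u| <= 2^-1 * s.
  apply: le_trans (normM p u) _; apply: (@le_trans _ _ ((`|p| + 1) * `|u|)).
    by rewrite ler_wpM2r ?lerDl.
  by rewrite mulrC -ler_pdivlMr// ltW.
have [||z zs zE] := @half_contraction_fixpoint R A
    (fun z => p * u - q * (z * z)) s s0.
- move=> x xs; apply: le_trans (ler_normB _ _) _.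
  apply: le_trans (lerD pu (qM x x s (ltW s0) (ler_pM _ _ xs xs))) _ => //.
  rewrite -mulrDl; apply: ler_piMl (ltW s0) _.
  have -> : (2^-1 + 4^-1 : R[i]) = 1 - 4^-1 by field.
  by rewrite lerBlDr lerDl invr_ge0.
- move=> x y xs ys.
  have -> : p * u - q * (x * x) - (p * u - q * (y * y)) =
     q * (y * (y - x)) + q * ((y - x) * x).
    rewrite -mulrDr mulrBr mulrBl addrA subrK mulrBr opprB addrC.
    by rewrite addrA subrK.
  rewrite distrC; apply: le_trans (ler_normD _ _) _.
  have -> : 2^-1 * `|y - x| = 4^-1 * `|y - x| + 4^-1 * `|y - x| by field.
  apply: lerD; apply: qM => //; first exact: ler_wpM2r.
  by rewrite mulrC ler_wpM2r.
by exists z; [exact: le_trans sr|].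
Qed.

(** The factors of h near F G are F + G^* z and G + F^* z, where z is the small
    root of s z + F^* G^* z^2 = h - F G and s = F^* F + G^* G. *)
Lemma open_multiplication_jointly_non_degenerate (R : realType)
    (A : banachStarAlgType R[i]) (F G : A) :
  (forall a b : A, a * b = b * a) ->
  jointly_non_degenerate F G -> open_multiplication_at F G.
Proof.
move=> AC [c [cF _]] e e0.
have normM (x y : A) : `|x * y| <= `|x| * `|y| by exact: bnormM.
have FG0 : 0 < `|star F| + `|star G| + 1 by rewrite ltr_wpDl ?addr_ge0.
have [d d0 dP] := @quadratic_small_root R A c (c * (star F * star G))
  (e / (`|star F| + `|star G| + 1)) (divr_gt0 e0 FG0).
have small (x z : A) : `|x| < `|star F| + `|star G| + 1 ->
    `|z| <= e / (`|star F| + `|star G| + 1) -> `|x * z| < e.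
  move=> xFG ze; apply: le_lt_trans (normM _ _) _.
  apply: le_lt_trans (ler_wpM2l (normr_ge0 x) ze) _.
  by rewrite mulrCA gtr_pMr// ltr_pdivrMr// mul1r.
exists d => // h; rewrite -ball_normE /= distrC => hd.
have [z ze zE] := dP _ hd.
exists (F + star G * z).
  rewrite /= opprD addNKr normrN small//.
  by rewrite -addrA -[ltLHS]addr0 addrCA ltrD2l ltr_wpDl.
exists (G + star F * z).
  rewrite /= opprD addNKr normrN small//.
  by rewrite -addrA ltrDl ltr_wpDl.
have : (star F * F + star G * G) * z = h - F * G - star F * star G * (z * z).
  by rewrite {1}zE mulrBr !mulrA cF !mul1r.
have -> : (F + star G * z) * (G + star F * z) =
   F * G + ((star F * F + star G * G) * z + star F * star G * (z * z)).
  rewrite mulrDl !mulrDr mulrDl -!addrA !mulrA (AC F) (AC _ G) !mulrA.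
  rewrite (AC G) -(mulrA _ z) (AC z) !mulrA (AC (star G) (star F)).
  by rewrite (AC F (star F)) (AC G (star G)).
by move=> ->; rewrite subrK addrC subrK.
Qed.

(** * Covers without triple intersections *)

(** The instance of covering dimension at most 1 for covers with three members,
    in a form that keeps track of which set shrinks to which. *)
Definition three_set_shrinking (T : topologicalType) :=
  forall u1 u2 u3 : set T, open u1 -> open u2 -> open u3 ->
    (forall x, [\/ u1 x, u2 x | u3 x]) ->
  exists v1 v2 v3 : set T, [/\ [/\ open v1, open v2 & open v3],
    [/\ v1 `<=` u1, v2 `<=` u2 & v3 `<=` u3],
    forall x, [\/ v1 x, v2 x | v3 x] & forall x, ~ [/\ v1 x, v2 x & v3 x]].

(** One triple (i, j, l) is treated by shrinking the three sets u_i, u_j and the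
    union w of all the other members, and by cutting the other members down to
    the shrunken w. All sets only get smaller, so triple intersections removed
    earlier stay empty. *)
Lemma finite_family_shrinking (T : topologicalType) (I : choiceType)
    (u : I -> set T) (s : seq (I * I * I)) : three_set_shrinking T ->
  (forall k, open (u k)) -> (forall x, exists k, u k x) ->
  exists v : I -> set T, [/\ forall k, open (v k), forall k, v k `<=` u k,
    forall x, exists k, v k x & forall i j l x, (i, j, l) \in s ->
      i != j -> l != i -> l != j -> v i x -> v j x -> ~ v l x].
Proof.
move=> shr uo uc; elim: s => [|[[i j] l] s [v [vo vu vc vs]]].
  by exists u; split=> [|k x||i j l x]; rewrite ?in_nil.
case: (altP (i =P j)) => [ij|ij].
  exists v; split => // i' j' l' x; rewrite inE => /predU1P[[-> -> _]|s'].
    by rewrite ij eqxx.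
  exact: (vs _ _ _ x s').
pose w := \bigcup_(k in [set k | k != i /\ k != j]) v k.
have [||||v1 [v2 [v3 [[vo1 vo2 vo3] [s1 s2 s3] c123 e123]]]] := shr (v i) (v j) w.
- exact: vo.
- exact: vo.
- by apply: bigcup_open => k _; exact: vo.
- move=> x; have [k vk] := vc x.
  case: (eqVneq k i) vk => [->|ki] vk; first by constructor 1.
  case: (eqVneq k j) vk => [->|kj] vk; first by constructor 2.
  by constructor 3; exists k.
exists (fun k => if k == i then v1 else if k == j then v2 else v3 `&` v k).
have vv k : (if k == i then v1 else if k == j then v2 else v3 `&` v k) `<=` v k.
  by have [->//|_] := eqVneq k i; have [->//|_] := eqVneq k j; exact: subIsetr.
split=> [k|k|x|i' j' l' x].
- by case: ifP => // _; case: ifP => // _; exact: openI.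
- exact: subset_trans (vv k) (vu k).
- case: (c123 x) => vx.
  + by exists i; rewrite eqxx.
  + by exists j; rewrite eq_sym (negbTE ij) eqxx.
  + have [k [/= ki kj] vk] := s3 _ vx.
    by exists k; rewrite (negbTE ki) (negbTE kj).
- rewrite inE => /predU1P[[-> -> ->]|s' ij' li lj] /=; last first.
    by move=> /vv vi /vv vj /vv; exact: vs vi vj.
  move=> _ li lj; rewrite (negbTE li) (negbTE lj) !eqxx eq_sym (negbTE ij).
  by move=> x1 x2 [x3 _]; apply: (e123 x).
Qed.

Lemma card_le_two (S : Type) (B : set S) :
  (forall a b c, B a -> B b -> B c -> [\/ a = b, c = a | c = b]) ->
  (B #<= `I_2)%card.
Proof.
move=> Bab; have [->|/set0P[a Ba]] := eqVneq B set0; first exact: card_ge0.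
have [b Bb] : exists b, forall c, B c -> c = a \/ c = b.
  have [[b [Bb ab]]|nb] := pselect (exists b, B b /\ a <> b).
    by exists b => c /(Bab a b c Ba Bb)[//|ca|cb]; [left | right].
  exists a => c Bc; left; apply: contrapT => ca; apply: nb; exists c.
  by split => // ac; apply: ca.
have BI : B `<=` (fun n => if n == 0%N then a else b) @` `I_2.
  by move=> c /Bb[]->; [exists 0%N | exists 1%N].
exact: card_le_trans (subset_card_le BI) (card_image_le _ _).
Qed.

Lemma covering_dim_le1_three_sets (T : topologicalType) :
  three_set_shrinking T -> covering_dim_le T 1.
Proof.
move=> shr U /finite_seqP[F ->] [Uo Uc].
pose I : finType := seq_sub F.
have [|x|v [vo vu vc vs]] := @finite_family_shrinking T I (fun k : I => ssval k)
  (enum ((I * I * I)%type : finType)) shr.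
- by move=> k; apply: Uo; exact: ssvalP.
- have [u uF ux] : (\bigcup_(u in [set` F]) u) x by rewrite Uc.
  by exists (SeqSub uF).
exists (range v); split.
- exact/finite_image/finite_finset.
- split=> [_ [k _ <-]//|]; apply/seteqP; split=> // x _.
  by have [k vk] := vc x; exists (v k) => //; exists k.
- by move=> _ [k _ <-]; exists (ssval k); [exact: ssvalP | exact: vu].
- move=> x; apply: card_le_two => _ _ _ [[i _ <-] ix] [[j _ <-] jx] [[l _ <-] lx].
  have [->|ij] := eqVneq i j; first by constructor 1.
  have [->|li] := eqVneq l i; first by constructor 2.
  have [->|lj] := eqVneq l j; first by constructor 3.
  by case: (vs i j l x (mem_enum _ _) ij li lj ix jx lx).
Qed.

Lemma covering_dim_le_transfer (S T : topologicalType) (f : S -> T) n :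
  continuous f -> bijective f -> (forall u, open u -> open (f @` u)) ->
  covering_dim_le S n -> covering_dim_le T n.
Proof.
move=> fc [g fK gK] fo Sn U Uf [Uo Uc].
have [||V [Vf [Vo Vc] VU Vn]] := Sn [set f @^-1` u | u in U].
- exact: finite_image.
- split=> [_ [u Uu <-]|].
    by apply: open_comp => [x _|]; [exact: fc | exact: Uo].
  apply/seteqP; split=> // x _; have [u Uu ux] : (\bigcup_(u in U) u) (f x) by rewrite Uc.
  by exists (f @^-1` u) => //; exists u.
exists [set f @` v | v in V]; split.
- exact: finite_image.
- split=> [_ [v /Vo vo <-]|]; first exact: fo.
  apply/seteqP; split=> // y _; have [v Vv vy] : (\bigcup_(v in V) v) (g y) by rewrite Vc.
  by exists (f @` v); [exists v | exists (g y)].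
- move=> _ [v Vv <-]; have [_ [u Uu <-] vu] := VU v Vv.
  by exists u => // _ [x /vu ux <-].
- move=> y; apply: card_le_trans (Vn (g y)).
  apply: card_le_trans (card_image_le (fun v => f @` v) _).
  apply: subset_card_le => _ [[v Vv <-] [x vx xy]].
  by exists v => //; split=> //; rewrite -xy fK.
Qed.

(** * Approximation by nowhere vanishing functions bounds the dimension *)

Lemma continuous_complex (R : realType) (T : topologicalType) (a b : T -> R) :
  continuous a -> continuous b -> continuous (fun x => a x +i* b x).
Proof.
move=> ac bc x; apply/(@cvgrPdist_lt _ _ _ (nbhs x)) => e e0.
have e20 : 0 < complex.Re e / 2 by rewrite divr_gt0// Re_gt0.
have /(@cvgrPdist_lt _ _ _ (nbhs x))/(_ _ e20) := ac x.
have /(@cvgrPdist_lt _ _ _ (nbhs x))/(_ _ e20) := bc x.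
apply: filterS2 => y by_ ay.
rewrite (gt0cRe e0) normcRe ltcR; apply: le_lt_trans (norm_le_ReIm _) _ => /=.
by rewrite [ltRHS]splitr ltrD.
Qed.

Lemma continuous_Im (R : realType) : continuous (@complex.Im R).
Proof.
move=> z; apply/(@cvgrPdist_lt _ _ _ (nbhs z)) => e e0; apply/nbhs_ballP.
exists e%:C => [|w]; first by rewrite /= ltcR.
rewrite /ball /= normcRe ltcR => zw.
by rewrite -raddfB; apply: le_lt_trans (le_Im_norm _) _.
Qed.

Lemma open_lt_fun (R : realType) (T : topologicalType) (a b : T -> R) :
  continuous a -> continuous b -> open [set x | a x < b x].
Proof.
move=> ac bc; have -> : [set x | a x < b x] = (fun x => b x - a x) @^-1` [set r | 0 < r].
  by apply/seteqP; split=> x /=; rewrite subr_gt0.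
apply: open_comp; last exact: open_gt.
by move=> x _; apply: continuousB; [exact: bc | exact: ac].
Qed.

Lemma compact_hausdorff_urysohn (R : realType) (X : compactHausdorffType) (A u : set X) :
  closed A -> open u -> A `<=` u ->
  exists p : X -> R, [/\ continuous p, forall x, A x -> p x = 1
    & forall x, ~ u x -> p x = 0].
Proof.
move=> cA ou Au.
have nX := compact_normal (@hausdorff_compact_space X) (@compact_space X).
have [|p [pc _ p0 p1]] := (@uniform_separatorP X R (~` u) A).1.
  apply: (@normal_separatorP R X).1 => //; first exact: open_closedC.
  by apply/seteqP; split=> // x [/= ux /Au].
exists p; split=> // x xA; first by apply: p1; exists x.
by apply: p0; exists x.
Qed.

(** The sets are treated in turn, each p_j being 1 where neither the earlier
    conditions p_k > 1/2 nor the later sets already account for the point. *)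
Lemma three_bumps (R : realType) (X : compactHausdorffType) (u1 u2 u3 : set X) :
  open u1 -> open u2 -> open u3 -> (forall x, [\/ u1 x, u2 x | u3 x]) ->
  exists p1 p2 p3 : X -> R,
    [/\ [/\ continuous p1, continuous p2 & continuous p3],
      forall x, ~ u1 x -> p1 x = 0, forall x, ~ u2 x -> p2 x = 0,
      forall x, ~ u3 x -> p3 x = 0
      & forall x, [\/ 2^-1 <= p1 x, 2^-1 <= p2 x | 2^-1 <= p3 x] ].
Proof.
move=> o1 o2 o3 u123.
have [||p1 [c1 p11 p10]] := @compact_hausdorff_urysohn R X (~` (u2 `|` u3)) u1 _ o1.
- by apply: open_closedC; exact: openU.
- by move=> x /not_orP[? ?]; case: (u123 x).
pose w1 := [set x | 2^-1 < p1 x].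
have ow1 : open w1 by apply: open_lt_fun => // x; exact: cvg_cst.
have [||p2 [c2 p21 p20]] := @compact_hausdorff_urysohn R X (~` (w1 `|` u3)) u2 _ o2.
- by apply: open_closedC; exact: openU.
- move=> x /not_orP[w1x n3]; apply: contrapT => n2; apply: w1x; rewrite /w1 /=.
  by rewrite p11; [rewrite invf_lt1 ?ltr1n | case].
pose w2 := [set x | 2^-1 < p2 x].
have ow2 : open w2 by apply: open_lt_fun => // x; exact: cvg_cst.
have [||p3 [c3 p31 p30]] := @compact_hausdorff_urysohn R X (~` (w1 `|` w2)) u3 _ o3.
- by apply: open_closedC; exact: openU.
- move=> x /not_orP[w1x w2x]; apply: contrapT => n3; apply: w2x; rewrite /w2 /=.
  by rewrite p21; [rewrite invf_lt1 ?ltr1n | case].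
exists p1, p2, p3; split=> // x.
have [w1x|w1x] := pselect (w1 x); first by constructor 1; exact: ltW.
have [w2x|w2x] := pselect (w2 x); first by constructor 2; exact: ltW.
by constructor 3; rewrite p31; [rewrite invf_le1 ?ler1n | case].
Qed.

(** The triple (a, b, 0) approximates (p1, p2, p3) up to a common additive
    constant, and its entries are not all equal. A maximal entry is therefore not
    minimal; its p_j is nonzero, as otherwise all three values would be at most
    1/4. *)
Lemma maximal_coordinate (R : realType) (p1 p2 p3 a b : R) :
  a != 0 \/ b != 0 -> `|p1 - p3 - a| < 8^-1 -> `|p2 - p3 - b| < 8^-1 ->
  [\/ 2^-1 <= p1, 2^-1 <= p2 | 2^-1 <= p3] ->
  [\/ p1 <> 0 /\ (b < a \/ 0 < a), p2 <> 0 /\ (a < b \/ 0 < b)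
    | p3 <> 0 /\ (a < 0 \/ b < 0)].
Proof.
move=> ab; rewrite !ltr_norml => /andP[? ?] /andP[? ?] p123.
have [ba|ab'] := leP b a; have [a0|a0] := leP 0 a; have [b0|b0] := leP 0 b.
all: try (constructor 1; split; [by move=> p0; case: p123; lra | lra]).
all: try (constructor 2; split; [by move=> p0; case: p123; lra | lra]).
all: try (constructor 3; split; [by move=> p0; case: p123; lra | lra]).
Qed.

Lemma not_three_nonminimal (R : realType) (a b : R) :
  (b < a \/ 0 < a) -> (a < b \/ 0 < b) -> (a < 0 \/ b < 0) -> False.
Proof. by move=> [] ? [] ? [] ?; lra. Qed.

Definition nonvanishing_dense (R : realType) (X : compactHausdorffType) :=
  forall (f : cfun R X) (e : R[i]), 0 < e ->
    exists g : cfun R X, (forall x, g x != 0) /\ (forall x, `|f x - g x| < e).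

(** With g a zero-free approximation of (p1 - p3) + i (p2 - p3), the j-th set is
    cut down to the points where the j-th entry of (Re g, Im g, 0) is not
    minimal. The three conditions exclude each other jointly, and at each point a
    maximal entry satisfies its condition. *)
Lemma nonvanishing_dense_three_sets (R : realType) (X : compactHausdorffType) :
  nonvanishing_dense R X -> three_set_shrinking X.
Proof.
move=> nd u1 u2 u3 o1 o2 o3 u123.
have [p1 [p2 [p3 [[c1 c2 c3] n1 n2 n3 p123]]]] := @three_bumps R X _ _ _ o1 o2 o3 u123.
have fc : continuous (fun x => (p1 x - p3 x) +i* (p2 x - p3 x) : R[i]).
  by apply: continuous_complex => x; apply: continuousB;
    by [exact: c1 | exact: c2 | exact: c3].
have e0 : 0 < (8^-1 : R)%:C by rewrite ltcR.
have [g [g0 fg]] := nd (mkcfun fc) _ e0.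
pose a x := complex.Re (g x); pose b x := complex.Im (g x).
have ac : continuous a.
  by move=> x; apply: continuous_comp; [exact: cfun_cont | exact: continuous_Re].
have bc : continuous b.
  by move=> x; apply: continuous_comp; [exact: cfun_cont | exact: continuous_Im].
have zc : continuous (fun _ : X => 0 : R) by move=> x; exact: cvg_cst.
exists (u1 `&` ([set x | b x < a x] `|` [set x | 0 < a x])),
  (u2 `&` ([set x | a x < b x] `|` [set x | 0 < b x])),
  (u3 `&` ([set x | a x < 0] `|` [set x | b x < 0])); split.
- by split; apply: openI => //; apply: openU; exact: open_lt_fun.
- by split; exact: subIsetl.
- move=> x; have fgx : complex.Re `|mkcfun fc x - g x| < 8^-1.
    by have := fg x; rewrite normcRe ltcR.
  have := le_lt_trans (le_Im_norm _) fgx; have := le_lt_trans (le_Re_norm _) fgx.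
  have ab : a x != 0 \/ b x != 0.
    have := g0 x; rewrite /a /b; case: (g x) => r s /=; rewrite eq_complex /=.
    by move/nandP.
  have -> : complex.Re (mkcfun fc x - g x) = (p1 x - p3 x) - a x by rewrite raddfB.
  have -> : complex.Im (mkcfun fc x - g x) = (p2 x - p3 x) - b x by rewrite raddfB.
  move=> h1 h2; case: (@maximal_coordinate R _ _ _ _ _ ab h1 h2 (p123 x)).
  + by move=> [px ?]; constructor 1; split=> //; apply: contrapT => /n1.
  + by move=> [px ?]; constructor 2; split=> //; apply: contrapT => /n2.
  + by move=> [px ?]; constructor 3; split=> //; apply: contrapT => /n3.
- by move=> x [[_ h1] [_ h2] [_ h3]]; exact: not_three_nonminimal h1 h2 h3.
Qed.

(** * Zero-free elements and characters *)

Lemma nonvanishing_invertible (R : realType) (X : compactHausdorffType) (f : cfun R X) :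
  (forall x, f x != 0) -> exists g : cfun R X, is_inverse f g.
Proof.
move=> f0; have gc : continuous (fun x => (f x)^-1).
  by move=> x; apply: cvgV; [exact: f0 | exact: cfun_cont].
by exists (mkcfun gc); split; apply: cfunP => x;
  [exact: mulfV (f0 x) | exact: mulVf (f0 x)].
Qed.

Lemma has_open_multiplication_at (K : numFieldType) (A : banachAlgType K) (F G : A) :
  has_open_multiplication A -> open_multiplication_at F G.
Proof.
move=> oA e e0; pose U := (ball F e)° `*` (ball G e)°.
have /oA oU : open U.
  rewrite openE => -[f g] [/= fF gG].
  by exists ((ball F e)°, (ball G e)°) => //; split; apply: open_nbhs_nbhs;
    split=> //; exact: open_interior.
have /nbhs_ballP[d /= d0 dU] : nbhs (F * G) [set p.1 * p.2 | p in U].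
  apply: open_nbhs_nbhs; split=> //; exists (F, G) => //.
  by split; exact: nbhsx_ballx.
exists d => // h /dU[[f g] [/interior_subset fF /interior_subset gG] <-].
by exists f => //; exists g.
Qed.

Definition uniformly_dense (R : realType) (X : compactHausdorffType)
    (A : Type) (i : A -> cfun R X) :=
  forall (f : cfun R X) (e : R[i]), 0 < e ->
    exists a : A, forall x, `|f x - i a x| < e.

Arguments uniformly_dense {R X A} i.

(** Any factorization of a a^* + c with c > 0 has factors without zeros on X, so
    it suffices that multiplication is open at the pairs (a, a^* ). *)
Lemma open_multiplication_nonvanishing_dense (R : realType) (X : compactHausdorffType)
    (A : banachStarAlgType R[i]) (i : {lrmorphism A -> cfun R X}) :
  star_preserving i ->
  (forall (a : A) (e : R[i]), 0 < e -> exists2 d : R[i], 0 < d &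
     forall b : A, ball a d b -> forall x, `|i a x - i b x| < e) ->
  uniformly_dense i ->
  (forall F G : A, open_multiplication_at F G) -> nonvanishing_dense R X.
Proof.
move=> i_star ic di oA f e e0.
have e20 : 0 < e / 2 by rewrite divr_gt0.
have [a fa] := di f _ e20; have [r r0 ra] := ic a _ e20.
have [d d0 dP] := oA a (star a) r r0.
pose c : R[i] := d / (`|1 : A| + 1).
have n10 : 0 < `|1 : A| + 1 by rewrite ltr_wpDl.
have c0 : 0 < c by rewrite divr_gt0.
have [|b br [b' _ bb']] := dP (a * star a + c *: 1).
  rewrite -ball_normE /= opprD addNKr normrN normrZ gtr0_norm//.
  by rewrite mulrAC ltr_pdivrMr// ltr_pM2l// ltrDl.
exists (i b); split=> x; last first.
  rewrite -(subrKA (i a x)) [e]splitr; apply: le_lt_trans (ler_normD _ _) _.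
  by rewrite ltrD// ra.
have : i (b * b') x != 0.
  have iZ : i (c *: 1) = c *: 1 by rewrite (linearZ_LR i) rmorph1.
  have iS : i (a * star a) = i a * star (i a) by rewrite -(i_star a) -rmorphM.
  have -> : i (b * b') = i a * star (i a) + c *: 1.
    by rewrite -iS -iZ bb' rmorphD.
  rewrite -[_ x]/(i a x * (i a x)^*%R + c * 1) -normCK mulr1.
  by rewrite gt_eqF// ltr_wpDl// exprn_ge0.
rewrite rmorphM -[_ x]/(i b x * i b' x).
by apply: contraNneq => ->; rewrite mul0r.
Qed.

(** If phi differs from every evaluation, compactness gives finitely many a_k in
    the kernel of phi without a common zero on X. Then sum_k a_k^* a_k lies in the
    kernel as well, but its image has no zero, so it is invertible in A. *)
Lemma character_evaluation (R : realType) (X : compactHausdorffType)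
    (A : banachStarAlgType R[i]) (i : {lrmorphism A -> cfun R X})
    (phi : {lrmorphism A -> R[i]}) :
  star_preserving i ->
  (forall (a : A) b, is_inverse (i a) b -> invertible a) ->
  exists x, forall a, phi a = i a x.
Proof.
move=> i_star inv; apply: contrapT => nx.
have nphi x : exists a, phi a = 0 /\ i a x != 0.
  have /existsNP[a /eqP ax] : ~ forall a, phi a = i a x by move=> h; apply: nx; exists x.
  have phi1 : phi (phi a *: 1) = phi a.
    by rewrite (linearZ_LR phi) rmorph1 [_ *: _]mulr1.
  have i1 : i (phi a *: 1) = phi a *: 1 by rewrite (linearZ_LR i) rmorph1.
  have phiB : phi (a - phi a *: 1) = phi a - phi a.
    by apply: etrans (rmorphB phi _ _) _; congr (_ - _).
  have iB : i (a - phi a *: 1) = i a - phi a *: 1 by rewrite -i1 rmorphB.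
  exists (a - phi a *: 1); rewrite phiB iB; split; first exact: subrr.
  by rewrite -[_ x]/(i a x - phi a * 1) mulr1 subr_eq0 eq_sym.
have cX : cover_compact [set: X] by rewrite -compact_cover; exact: compact_space.
have [a pa|x _|D Dphi Dc] := cX A [set a | phi a = 0] (fun a => [set x | i a x != 0]).
- rewrite (_ : mkset _ = (fun x => i a x) @^-1` (~` [set 0])).
    apply: open_comp => [x _|]; first exact: cfun_cont.
    apply: closed_openC; apply: accessible_closed_set1.
    by apply: hausdorff_accessible; exact: (@norm_hausdorff _ R[i]).
  by apply/seteqP; split=> x /= /eqP.
- by have [a [pa ax]] := nphi x; exists a.
pose s := \sum_(a <- finmap.enum_fset D) star a * a.
have sE x : i s x = \sum_(a <- finmap.enum_fset D) `|i a x| ^+ 2.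
  rewrite /s; elim: (finmap.enum_fset D) => [|a l ih].
    by rewrite !big_nil rmorph0.
  rewrite !big_cons -ih normCK mulrC -[_ x]/((i (_ + _)) x).
  have -> u : i (star a * a + u) = star (i a) * i a + i u.
    by rewrite -i_star -rmorphM -rmorphD.
  by [].
have s0 x : i s x != 0.
  have [a aD ax] := Dc x I; rewrite sE psumr_eq0 => [|a' _]; last exact: exprn_ge0.
  by apply/allPn; exists a => //=; rewrite expf_eq0/= normr_eq0.
have [g /inv[t [st _]]] := @nonvanishing_invertible R X (i s) s0.
have phi_s : phi s = 0.
  rewrite /s raddf_sum big1_seq// => a /andP[_ aD].
  have pa : phi a = 0 := set_mem (Dphi a aD).
  apply: etrans (rmorphM phi _ _) _.
  exact: etrans (congr1 (fun z => _ * z) pa) (mulr0 _).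
have : phi (s * t) = phi s * phi t by exact: rmorphM.
by rewrite st rmorph1 phi_s mul0r => /eqP; rewrite oner_eq0.
Qed.

(** * The maximal ideal space *)

Section EvaluationCharacter.
Variables (R : realType) (X : compactHausdorffType) (A : banachAlgType R[i]).
Variables (i : {lrmorphism A -> cfun R X}) (x : X).

Definition evaluation (a : A) : R[i] := i a x.

Fact evaluation_linear : linear evaluation.
Proof. by move=> c a b; rewrite /evaluation linearP. Qed.

Fact evaluation_monoid_morphism : monoid_morphism evaluation.
Proof.
by split=> [|a b]; rewrite /evaluation ?rmorph1 ?rmorphM.
Qed.

HB.instance Definition _ :=
  GRing.isLinear.Build R[i] A R[i] *:%R evaluation evaluation_linear.
HB.instance Definition _ :=
  GRing.isMonoidMorphism.Build A R[i] evaluation evaluation_monoid_morphism.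

Definition evaluation_character : maximal_ideal_space A :=
  (evaluation : {lrmorphism A -> R[i]}).

End EvaluationCharacter.

Arguments evaluation_character {R X A} i x.

Lemma characterP (R : realType) (A : banachAlgType R[i])
    (phi psi : {lrmorphism A -> R[i]}) : phi =1 psi -> phi = psi.
Proof.
case: phi psi => f [[f1] [f2] [f3]] [g [[g1] [g2] [g3]]] /= /funext fg.
move: g1 g2 g3; rewrite -fg => g1 g2 g3.
by rewrite (Prop_irrelevance f1 g1) (Prop_irrelevance f2 g2) (Prop_irrelevance f3 g3).
Qed.

Lemma gelfand_transform_continuous (R : realType) (A : banachAlgType R[i]) (a : A) :
  continuous ((fun phi => (phi : {lrmorphism A -> R[i]}) a) : maximal_ideal_space A -> R[i]).
Proof.
move=> phi.
apply: (continuous_comp (f := (fun phi : maximal_ideal_space A =>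
    ((phi : {lrmorphism A -> R[i]}) : {ptws A -> R[i]}))) (g := fun f : {ptws A -> R[i]} => f a)).
  exact: initial_continuous.
exact: (@proj_continuous A (fun=> R[i]) a).
Qed.

Lemma evaluation_character_continuous (R : realType) (X : compactHausdorffType)
    (A : banachAlgType R[i]) (i : {lrmorphism A -> cfun R X}) :
  continuous (evaluation_character i).
Proof.
apply: continuous_comp_initial => x.
apply/cvg_sup => a U [_ [[W oW <-]] /= Wax /filterS]; apply.
by apply: (@cfun_cont R X (i a)); exact: open_nbhs_nbhs.
Qed.

(** Any element within 1/2 of a Urysohn function that is 1 at x and 0 off u. *)
Lemma separating_element (R : realType) (X : compactHausdorffType)
    (A : banachAlgType R[i]) (i : {lrmorphism A -> cfun R X}) (x : X) (u : set X) :
  uniformly_dense i ->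
  open u -> u x ->
  exists a : A, 2^-1 < complex.Re (i a x) /\
    forall y, 2^-1 < complex.Re (i a y) -> u y.
Proof.
move=> di ou ux.
have cx : closed [set x].
  exact: accessible_closed_set1 (hausdorff_accessible (@hausdorff_compact_space X)) x.
have [|p [pc p1 p0]] := @compact_hausdorff_urysohn R X _ _ cx ou.
  by move=> _ ->.
have zc : continuous (fun _ : X => 0 : R) by move=> y; exact: cvg_cst.
have e0 : 0 < (2^-1 : R)%:C by rewrite ltcR invr_gt0.
have [a pa] := di (mkcfun (@continuous_complex R X p _ pc zc)) _ e0.
have {}pa y : `|p y - complex.Re (i a y)| < 2^-1.
  have -> : p y - complex.Re (i a y) =
    complex.Re (mkcfun (@continuous_complex R X p _ pc zc) y - i a y) by rewrite raddfB.
  by apply: le_lt_trans (le_Re_norm _) _; rewrite -ltcR -normcRe.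
exists a; split.
  by have := pa x; rewrite p1// ltr_norml => /andP[_]; lra.
move=> y ay; apply: contrapT => /p0 py.
by have := pa y; rewrite py ltr_norml => /andP[]; lra.
Qed.

(** The elements of A that separate a point of X from a closed set make
    evaluation injective and open; it is onto by hypothesis. *)
Lemma covering_dim_maximal_ideal_space (R : realType) (X : compactHausdorffType)
    (A : banachAlgType R[i]) (i : {lrmorphism A -> cfun R X}) n :
  uniformly_dense i ->
  (forall phi : {lrmorphism A -> R[i]}, exists x, forall a, phi a = i a x) ->
  covering_dim_le X n -> covering_dim_le (maximal_ideal_space A) n.
Proof.
move=> di sur; apply: (@covering_dim_le_transfer _ _ (evaluation_character i)).
- exact: evaluation_character_continuous.
- have inj : injective (evaluation_character i).
    move=> x y xy; apply: contrapT => nxy.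
    have cy : closed [set y].
      exact: accessible_closed_set1 (hausdorff_accessible (@hausdorff_compact_space X)) y.
    have [//|a [ax ay]] := @separating_element _ _ _ i x _ di (closed_openC cy).
    have axy : i a x = i a y.
      exact: (congr1 (fun phi : maximal_ideal_space A => (phi : {lrmorphism A -> R[i]}) a) xy).
    by rewrite axy in ax; exact: (ay y ax).
  pose g (phi : maximal_ideal_space A) := projT1 (cid (sur phi)).
  have gP phi : evaluation_character i (g phi) = phi.
    by apply: characterP => a; rewrite /g; case: cid => x /= ->.
  by exists g => // x; apply: inj.
- move=> u ou; rewrite openE => _ [x ux <-].
  have [a [ax au]] := @separating_element _ _ _ i x u di ou ux.
  pose W := (fun phi : maximal_ideal_space A =>
      complex.Re ((phi : {lrmorphism A -> R[i]}) a)) @^-1` [set r | 2^-1 < r].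
  have oW : open W.
    apply: open_comp; last exact: open_gt.
    move=> phi _.
    exact: (continuous_comp (@gelfand_transform_continuous R A a phi)
              (@continuous_Re R _)).
  apply: filterS (open_nbhs_nbhs (conj oW _ : open_nbhs (evaluation_character i x) W)).
    move=> phi; rewrite /W /=; have [y phiy] := sur phi.
    rewrite phiy => /au uy; exists y => //.
    by apply: characterP => b; rewrite phiy.
  exact: ax.
Qed.

(** * Openness of multiplication and dimension *)

Theorem theoremA (R : realType) (X : compactHausdorffType)
    (A : banachStarAlgType R[i]) (i : {lrmorphism A -> cfun R X})
    (i_star : star_preserving i)
    (i_nci : norm_controlled_inversion i)
    (cases : is_cfun_algebra X A \/
      exists (E : completeNormedModType R[i]) (J : A -> {linear E -> R[i]}),
        dual_banach_algebra J /\ shares_densely_many_points J i) :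
  (forall F G : A, jointly_non_degenerate F G -> open_multiplication_at F G) /\
  (dense (range i) -> has_open_multiplication A ->
   covering_dim_le (maximal_ideal_space A) 1).
Proof.
have [ic inj [h [_ hi]]] := i_nci.
have AC (a b : A) : a * b = b * a.
  apply: inj; apply: etrans (rmorphM i _ _) _; apply: etrans (mulrC _ _) _.
  by apply: esym; exact: rmorphM.
split=> [F G|di oA]; first exact: open_multiplication_jointly_non_degenerate.
have icx (a : A) (e : R[i]) : 0 < e -> exists2 d : R[i], 0 < d &
     forall b : A, ball a d b -> forall x, `|i a x - i b x| < e.
  move=> e0.
  have nb : nbhs (i a) [set g | `|i a - g| < e] by apply/nbhs_ballP; exists e.
  have /nbhs_ballP[d /= d0 dP] := ic a _ nb.
  exists d => // b /dP bd x.
  refine (le_lt_trans _ bd).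
  exact: (le_cfun_norm (i a - i b)).
have dix : uniformly_dense i.
  move=> f e e0.
  have nb : nbhs f [set g | `|f - g| < e] by apply/nbhs_ballP; exists e.
  have [||g [/interior_subset fg [a _ ag]]] := di ([set g | `|f - g| < e]°).
  - by exists f.
  - exact: open_interior.
  exists a => x; rewrite ag.
  refine (le_lt_trans _ fg).
  exact: (le_cfun_norm (f - g)).
apply: (@covering_dim_maximal_ideal_space R X A i) => //.
  move=> phi; apply: character_evaluation => // a b /hi[a' aa' _].
  by exists a'.
apply: covering_dim_le1_three_sets.
apply: (@nonvanishing_dense_three_sets R).
refine (@open_multiplication_nonvanishing_dense R X A i i_star icx dix _) => F G.
refine (@has_open_multiplication_at _ A F G oA).
Qed.
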